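(* Let $d\ge 1$, let $\vartheta>0$ and $\sigma>0$, and let $\Phi(N,n)$ be complex weights ($N\ge 1$ integer, $n\in\mathbb Z$) such that for every $N$ the function $n\mapsto\Phi(N,n)$ has bounded support and $\sum_{n=-\infty}^{+\infty}\Phi(N,n)=1$. Assume that there exist $H>0$ and an infinite set of positive integers $N$ for which, for every $t\in\mathbb R$, the sum $\sum_n\Phi(N,n)e^{2\pi i n t}$ is real and $$\sum_{n=-\infty}^{+\infty}\Phi(N,n)e^{2\pi i n t}\ge H(1+N\|t\|)^{-\vartheta}.$$ Assume also that for a given $\alpha\in\mathbb R^d$ there exist $L>0$ and an infinite subset $\Omega$ of $\mathbb Z^d\setminus\{0\}$ with $\|\alpha\cdot m\|\le L|m|^{-\sigma}$ for every $m\in\Omega$. Then there exists a function $f\in W^{\vartheta\sigma,2}(\mathbb T^d)$ such that $$\limsup_{N\to+\infty}\left\{N^{\vartheta}\sup_{x\in\mathbb T^d}\left|\mathcal D_N^{\Phi,\alpha}f(x)\right|\right\}=+\infty.$$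
   Context: $\mathbb T^d=\mathbb R^d/\mathbb Z^d$; functions on $\mathbb T^d$ are identified with $\mathbb Z^d$-periodic functions on $\mathbb R^d$. For real $t$, $\|t\|=\inf_{n\in\mathbb Z}|t-n|$. Fourier coefficients: $\widehat f(m)=\int_{\mathbb T^d}f(x)e^{-2\pi i m\cdot x}dx$, $m\in\mathbb Z^d$. For $\delta>0$, $W^{\delta,2}(\mathbb T^d)$ is the space of distributions on $\mathbb T^d$ with $\|f\|_{\delta,2}=\left(\sum_{m\in\mathbb Z^d}(1+|m|^2)^\delta|\widehat f(m)|^2\right)^{1/2}<\infty$. Since elements of this space are defined up to null sets, the supremum is understood as an essential supremum (it is the ordinary supremum for the continuous representative when there is one). The weighted discrepancy is $$\mathcal D_N^{\Phi,\alpha}f(x)=\sum_{n=-\infty}^{+\infty}\Phi(N,n)f(x+n\alpha)-\int_{\mathbb T^d}f(y)\,dy .$$ *)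

(* Defs.v *)
From HB Require Import structures.
From mathcomp Require Import all_boot all_order all_algebra.
From mathcomp Require Import all_classical all_reals all_analysis.
From mathcomp Require Import ess_sup_inf complex.

Set Implicit Arguments.
Unset Strict Implicit.
Unset Printing Implicit Defensive.

Import Order.TTheory GRing.Theory Num.Theory.
Import numFieldNormedType.Exports.

Local Open Scope classical_set_scope.
Local Open Scope ring_scope.

Section TorusMeasure.
Context (R : realType).
Local Notation mR := (measurableTypeR R).

Definition tuple_cons n (p : mR * n.-tuple mR) : n.+1.-tuple mR :=
  [the n.+1.-tuple mR of p.1 :: p.2].

Lemma measurable_tuple_cons n : measurable_fun setT (@tuple_cons n).
Proof. exact: measurable_cons. Qed.

HB.instance Definition _ n :=
  isMeasurableFun.Build _ _ _ _ (@tuple_cons n) (@measurable_tuple_cons n).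

(* The d-fold product of the uniform probability on [0, 1], that is, Lebesgue
   measure on the fundamental cube: the normalised Haar measure of R^d/Z^d.
   The library has product measures on pairs only, and puts the product
   sigma-algebra on tuples. *)
Fixpoint torus_measure (d : nat) : probability (d.-tuple mR) R :=
  if d is n.+1 then
    distribution (uniform_prob (@ltr01 R) \x torus_measure n)%E
      (@tuple_cons n)
  else dirac [tuple].

End TorusMeasure.

Section Defs.
Context (R : realType).

Definition row_of d (t : d.-tuple (measurableTypeR R)) : 'rV[R]_d := \row_i tnth t i.

Definition int_row d (k : 'rV[int]_d) : 'rV[R]_d := map_mx intr k.

Definition dotp d (x y : 'rV[R]_d) : R := \sum_i x 0 i * y 0 i.

Definition enorm d (x : 'rV[R]_d) : R := Num.sqrt (dotp x x).

Definition dist_int (t : R) : R := inf [set `|t - n%:~R| | n in [set: int]].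

Definition cexp2pi (t : R) : R[i] :=
  (cos (2 * pi * t) +i* sin (2 * pi * t))%C.

Definition Zd_periodic d (f : 'rV[R]_d -> R[i]) : Prop :=
  forall (x : 'rV[R]_d) (k : 'rV[int]_d), f (x + int_row k) = f x.

Definition torus_integrable d (f : 'rV[R]_d -> R[i]) : Prop :=
  (torus_measure R d).-integrable setT (fun t => (complex.Re (f (row_of t)))%:E)
  /\
  (torus_measure R d).-integrable setT (fun t => (complex.Im (f (row_of t)))%:E).

Definition torus_integral d (f : 'rV[R]_d -> R[i]) : R[i] :=
  (Rintegral (torus_measure R d) setT (fun t => complex.Re (f (row_of t))) +i*
   Rintegral (torus_measure R d) setT (fun t => complex.Im (f (row_of t))))%C.

Definition torus_esssup d (g : 'rV[R]_d -> R) : \bar R :=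
  ess_sup (torus_measure R d) (fun t => (g (row_of t))%:E).

Definition fourier_coef d (f : 'rV[R]_d -> R[i]) (m : 'rV[int]_d) : R[i] :=
  torus_integral (fun x => f x * cexp2pi (- dotp (int_row m) x)).

Definition sobolev_norm d (delta : R) (f : 'rV[R]_d -> R[i]) : \bar R :=
  ((\esum_(m in [set: 'rV[int]_d])
     ((1 + enorm (int_row m) ^+ 2) `^ delta *
      ComplexField.Normc.normc (fourier_coef f m) ^+ 2)%:E) `^ 2^-1)%E.

(* For delta > 0 a distribution of finite norm is an L^2 function, so it has an
   integrable representative, and an integrable function is determined almost
   everywhere by its Fourier coefficients. *)
Definition sobolev d (delta : R) (f : 'rV[R]_d -> R[i]) : Prop :=
  [/\ Zd_periodic f, torus_integrable f & (sobolev_norm delta f < +oo)%E].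

Definition weighted_discrepancy d (Phi : nat -> int -> R[i])
    (alpha : 'rV[R]_d) (f : 'rV[R]_d -> R[i]) (N : nat) (x : 'rV[R]_d) : R[i] :=
  \sum_(n \in [set: int]) Phi N n * f (x + n%:~R *: alpha) - torus_integral f.

End Defs.

(* Main.v *)
(** The function is a lacunary series f(x) = sum_j a_j e(m_j . x) with m_j in
    Omega and a_j = |m_j|^(- theta sigma) / (j + 1).  The m_j are chosen with
    |m_j|^(theta sigma) >= 2^j, which makes the series absolutely convergent,
    and the squared Sobolev norm is at most a constant times sum_j 1 / (j + 1)^2.
    The discrepancy multiplies the m_j-th coefficient by the nonnegative number
    K_N(alpha . m_j), so its value at the origin is sum_j a_j K_N(alpha . m_j).
    As soon as |m_j|^sigma <= N, the two hypotheses give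
    N^theta a_j K_N(alpha . m_j) >= c / (j + 1), and the harmonic series
    diverges.  By continuity the value at the origin is, up to any given error
    and a factor 1/2, a lower bound on a whole box around it, hence for the
    essential supremum. *)
Require Import Defs.
From mathcomp Require Import all_boot all_order all_algebra.
From mathcomp Require Import all_classical all_reals all_analysis.
From mathcomp Require Import ess_sup_inf complex.
From mathcomp Require Import measurable_realfun ring lra zify.
Import Order.TTheory GRing.Theory Num.Theory.
Import numFieldNormedType.Exports.
Local Open Scope classical_set_scope.
Local Open Scope ring_scope.

(** * Cosine integrals over the unit interval *)

Section TorusIntegral.
Set Implicit Arguments.
Unset Strict Implicit.
Context {R : realType}.
Local Notation mR := (measurableTypeR R).

Lemma cosD2piz (x : R) (k : int) : cos (x + 2 * pi * k%:~R) = cos x.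
Proof.
have cosDn (y : R) (n : nat) : cos (y + 2 * pi * n%:R) = cos y.
  rewrite -(periodicn (@cosD2pi R) n y); congr (cos (_ + _)).
  by rewrite -[pi *+ 2]mulr_natl -[RHS]mulr_natr.
case: k => n; first exact: cosDn.
(* [Negz n] is -(n + 1), so the natural case applied at the shifted point with [n.+1] periods
   returns to [x]. *)
rewrite -(cosDn (x + 2 * pi * (Negz n)%:~R) n.+1) -addrA -mulrDr NegzE.
by rewrite mulrNz addNr mulr0 addr0.
Qed.

Lemma measurable_cos_comp d (T : measurableType d) (f : T -> R) :
  measurable_fun setT f -> measurable_fun setT (fun x => cos (f x)).
Proof.
move=> mf; apply: (measurableT_comp _ mf).
exact: continuous_measurable_fun (@continuous_cos R).
Qed.

Lemma integrable_cos_comp d (T : measurableType d) (P : probability T R)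
    (f : T -> R) :
  measurable_fun setT f -> P.-integrable setT (fun x => (cos (f x))%:E).
Proof.
move=> mf; apply: measurable_bounded_integrable => //.
- by rewrite (le_lt_trans (probability_le1 _ _))// ltry.
- exact: measurable_cos_comp.
- exists 1; split; first by rewrite realE ler01.
  by move=> y y1 x _; apply: le_trans (cos_max _) (ltW y1).
Qed.

Lemma integral_cos_unit_interval (k : int) (c : R) :
  (\int[uniform_prob (@ltr01 R)]_x (cos (2 * pi * (k%:~R * x) + c))%:E =
   ((k == 0)%:R * cos c)%:E)%E.
Proof.
have [->|k0] := eqVneq k 0.
  under eq_integral do rewrite mul0r mulr0 add0r.
  rewrite integral_cst//= probability_setT mule1.
  by rewrite mul1r.
rewrite mul0r.
set w : R := 2 * pi * k%:~R.
have w0 : w != 0.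
  by rewrite !mulf_neq0 ?intr_eq0// ?gt_eqF// pi_gt0.
have mw : measurable_fun setT (fun x : mR => 2 * pi * (k%:~R * x) + c).
  apply: measurable_funD => //; apply: measurable_funM => //.
have icos := @integrable_cos_comp _ _ (uniform_prob (@ltr01 R)) _ mw.
(* Adding 1 makes the integrand nonnegative, as [integral_uniform] requires; the constant is
   subtracted again here. *)
suff H : (\int[uniform_prob (@ltr01 R)]_x
    (1 + cos (2 * pi * (k%:~R * x) + c))%:E = 1)%E.
  move: H; under eq_integral do rewrite EFinD.
  rewrite integralD//; last exact: finite_measure_integrable_cst.
  rewrite integral_cst//= probability_setT mul1e.
  case: (\int[_]_x (cos _)%:E)%E => [r||]//; rewrite -EFinD => -[H].
  by congr EFin; lra.
have wE x : 2 * pi * (k%:~R * x) + c = w * x + c by rewrite /w mulrA.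
under eq_integral do rewrite wE.
rewrite integral_uniform; last 2 first.
- apply/measurable_EFinP; apply: measurable_funD => //.
  by apply: measurable_cos_comp; apply: measurable_funD => //; apply: measurable_funM.
- by move=> x; rewrite lee_fin -lerBlDl sub0r cos_geN1.
rewrite subr0 invr1 mul1e.
pose F (x : R) : R := x + w^-1 * sin (w * x + c).
have dF (x : R) : is_derive x 1 F (1 + cos (w * x + c)).
  have dl : is_derive x 1 (fun x : R => w * x + c) w.
    by apply: is_derive_eq; rewrite scaler1 addr0.
  rewrite /F; apply: is_derive_eq.
  by rewrite ?scaler1 ?scaler0 ?addr0 ?add0r; rewrite /GRing.scale /=; field.
have cF x : {for x, continuous F}.
  by apply/differentiable_continuous/derivable1_diffP; case: (dF x).
rewrite (@continuous_FTC2 R _ F) //.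
- rewrite -EFinD /F; congr EFin; rewrite mulr1 mulr0 add0r add0r.
  have -> : sin (w + c) = sin c.
    rewrite -!cosBpihalf -[in RHS](cosD2piz _ k); congr cos.
    by rewrite /w; ring.
  by ring.
- apply: continuous_subspaceT => x.
  apply: cvgD; first exact: cvg_cst.
  apply: (@continuous_comp _ _ _ (fun x => w * x + c) cos); last exact: continuous_cos.
  apply: cvgD; last exact: cvg_cst.
  exact: mulrl_continuous.
- split.
  + by move=> x _; case: (dF x).
  + exact: cvg_at_right_filter (cF _).
  + exact: cvg_at_left_filter (cF _).
- by move=> x _; rewrite derive1E derive_val.
Qed.

End TorusIntegral.

(** * The torus measure: integrals of characters and mass of small boxes *)

Section TorusMeasureTheory.
Set Implicit Arguments.
Unset Strict Implicit.
Context {R : realType}.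
Local Notation mR := (measurableTypeR R).

(** The offset [c] serves twice: 0 and - pi / 2 give the real and imaginary parts of the character,
    and in an induction on [d] it absorbs the first coordinate. *)
Definition character_phase d (m : 'rV[int]_d) (c : R) (t : d.-tuple mR) : R :=
  2 * pi * dotp (int_row R m) (row_of t) + c.

Lemma measurable_character_phase d (m : 'rV[int]_d) (c : R) :
  measurable_fun setT (character_phase m c).
Proof.
apply: measurable_funD => //; apply: measurable_funM => //.
rewrite (_ : (fun t => _) = (fun t : d.-tuple mR =>
    \sum_(i < d) int_row R m 0 i * tnth t i)); last first.
  by apply/funext => t; rewrite /dotp; apply: eq_bigr => i _; rewrite [row_of t _ _]mxE.
apply: measurable_sum => i; apply: measurable_funM => //.
exact: measurable_tnth.
Qed.

Lemma character_phase_cons d (m : 'rV[int]_d.+1) (c : R) (p : mR * d.-tuple mR) :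
  character_phase m c (tuple_cons p) =
  character_phase (\row_i m 0 (lift ord0 i)) (2 * pi * ((m 0 0)%:~R * p.1) + c) p.2.
Proof.
rewrite /character_phase /dotp big_ord_recl !mxE tnth0 mulrDr addrCA addrA.
congr (_ + _ + _); congr (_ * _); apply: eq_bigr => i _.
by rewrite !mxE tnthS.
Qed.

(** Fubini and induction on the dimension, with [c] arbitrary: the other coordinates are integrated
    first, the first one being part of the phase, and what remains is an integral over the unit
    interval. *)
Lemma integral_torus_cos d (m : 'rV[int]_d) (c : R) :
  (\int[torus_measure R d]_t (cos (character_phase m c t))%:E =
   ((m == 0)%:R * cos c)%:E)%E.
Proof.
elim: d m c => [|d IH] m c.
  have -> : m = 0 by apply/rowP => -[].
  rewrite eqxx mul1r integral_dirac//=; last first.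
    apply/measurable_EFinP; apply: measurable_cos_comp.
    exact: measurable_character_phase.
  by rewrite diracT mul1e /character_phase /dotp big_ord0 mulr0 add0r.
have mcons : measurable_fun setT (fun p => character_phase m c (tuple_cons p)).
  apply: measurableT_comp; first exact: measurable_character_phase.
  exact: measurable_tuple_cons.
rewrite /= integral_distribution; last 2 first.
- apply/measurable_EFinP; apply: measurable_cos_comp.
  exact: measurable_character_phase.
- exact: integrable_cos_comp.
rewrite -integral12_prod_meas1; last exact: integrable_cos_comp.
pose m' := \row_i m 0 (lift ord0 i).
under eq_integral => x _.
  rewrite /fubini_F /=.
  under eq_integral do rewrite character_phase_cons /=.
  rewrite IH EFinM; over.
rewrite /= integralZl//; last first.
  apply: integrable_cos_comp.
  apply: measurable_funD => //; apply: measurable_funM => //.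
rewrite integral_cos_unit_interval -EFinM mulrA -natrM mulnb.
congr ((_ %:R * _)%:E); congr nat_of_bool.
apply/andP/eqP => [[/eqP m'0 /eqP m00]|->].
  apply/rowP => i; rewrite mxE.
  case: (unliftP ord0 i) => [j|] ->//.
  by move/rowP/(_ j): m'0; rewrite !mxE.
by rewrite mxE eqxx; split=> //; apply/eqP/rowP => i; rewrite !mxE.
Qed.

Lemma measurable_box d (e : R) :
  measurable [set t : d.-tuple mR | forall i, `|tnth t i| <= e].
Proof.
rewrite (_ : mkset _ = \bigcap_(i in [set: 'I_d]) (fun t => tnth t i) @^-1` `[-e, e]).
  apply: fin_bigcap_measurable => // i _.
  rewrite -[X in measurable X]setTI; exact: measurable_tnth.
apply/seteqP; split => t /= te i => [_|].
  by rewrite /= in_itv/= -ler_norml.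
by have := te i I; rewrite /= in_itv/= -ler_norml.
Qed.

Lemma torus_measure_box_gt0 d (e : R) : 0 < e ->
  (0 < torus_measure R d [set t | forall i, (`|tnth t i| <= e)%R])%E.
Proof.
move=> e0; elim: d => [|d IH] /=.
  by rewrite diracE mem_set// => -[].
rewrite /distribution /pushforward /=.
rewrite (_ : _ @^-1` _ = [set x : mR | `|x| <= e] `*`
    [set t : d.-tuple mR | forall i, `|tnth t i| <= e]); last first.
  apply/seteqP; split => -[x t] /=.
    move=> xt; split; first by have := xt ord0; rewrite tnth0.
    by move=> i; have := xt (lift ord0 i); rewrite tnthS.
  move=> [xe te] i; case: (unliftP ord0 i) => [j|] ->; last by rewrite tnth0.
  by rewrite tnthS.
have mbox := @measurable_box d e.
have mA : measurable [set x : mR | `|x| <= e].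
  rewrite (_ : mkset _ = `[-e, e]%classic)//.
  by apply/seteqP; split => x; rewrite /= in_itv/= ler_norml.
rewrite product_measure1E//.
have min0 : 0 < Num.min e 1 by rewrite lt_min e0 ltr01.
have PE : uniform_prob (@ltr01 R) [set x : mR | `|x| <= e] =
    lebesgue_measure ([set x : mR | `|x| <= e] `&` `[0, 1]).
  (* Integrating the indicator turns the uniform law into Lebesgue measure restricted to [0, 1]. *)
  transitivity (\int[uniform_prob (@ltr01 R)]_x
      (\1_([set x : mR | `|x| <= e]) x)%:E)%E.
    by rewrite integral_indic// setIT.
  rewrite integral_uniform.
  - by rewrite subr0 invr1 mul1e integral_indic.
  - by apply/measurable_EFinP; exact: measurable_indic.
  - by move=> x; rewrite lee_fin.
rewrite mule_gt0// [X in (0 < X)%E]PE.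
(* The measure lives on [0, 1], so only the nonnegative part of the interval counts; [Num.min]
   covers the case e > 1. *)
apply: (@lt_le_trans _ _ (lebesgue_measure (`[0, Num.min e 1]%classic : set R))).
  by rewrite lebesgue_measure_itv/= lte_fin min0 -EFinB subr0 lte_fin.
apply: le_measure; rewrite ?inE//; first exact: measurableI.
move=> x /=; rewrite !in_itv/= le_min => /and3P[x0 xe x1].
by rewrite x0 x1 ger0_norm.
Qed.

End TorusMeasureTheory.

(** * Absolutely convergent cosine series and their integrals *)

Section CosineSeries.
Context {R : realType}.
Set Implicit Arguments.
Unset Strict Implicit.
Local Notation mR := (measurableTypeR R).
Variable a : R ^nat.
Hypothesis a_ge0 : forall j, 0 <= a j.
Hypothesis cvg_a : cvgn (series a).

(** Since sin u = cos (u - pi / 2), this one real series provides both the real and the imaginary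
    part of an exponential series. *)
Definition cos_series (p : R ^nat) : R := limn (series (fun j => a j * cos (p j))).

Lemma eq_cos_series (p q : R ^nat) :
  (forall j, cos (p j) = cos (q j)) -> cos_series p = cos_series q.
Proof.
move=> pq; rewrite /cos_series (_ : (fun j => a j * cos (p j)) = fun j => a j * cos (q j))//.
by apply/funext => j; rewrite pq.
Qed.

Lemma cvg_cos_series (p : R ^nat) :
  series (fun j => a j * cos (p j)) @ \oo --> cos_series p.
Proof.
apply: normed_cvg; apply: series_le_cvg cvg_a => // j; first by rewrite normr_ge0.
by rewrite /= normrM ger0_norm// ler_piMr// cos_max.
Qed.

(** Carries the addition formulas through the infinite sum; this is how multiplication by a fixed
    character becomes a shift of the phases. *)
Lemma cos_series_comb (p q r : R ^nat) (u v : R) :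
  (forall j, cos (p j) * u + cos (q j) * v = cos (r j)) ->
  cos_series p * u + cos_series q * v = cos_series r.
Proof.
move=> pqr; apply/esym/cvg_lim => //.
have -> : series (fun j => a j * cos (r j)) =
    (fun n => series (fun j => a j * cos (p j)) n * u +
              series (fun j => a j * cos (q j)) n * v).
  apply/funext => n; rewrite /series /= !mulr_suml -big_split/=.
  by apply: eq_bigr => j _; rewrite -!mulrA -mulrDr pqr.
by apply: cvgD; apply: cvgMr_tmp; exact: cvg_cos_series.
Qed.

Lemma series_cos_le (p : R ^nat) n :
  `|series (fun j => a j * cos (p j)) n| <= limn (series a).
Proof.
apply: le_trans (ler_norm_sum _ _ _) _.
apply: (@le_trans _ _ (series a n)).
  by apply: ler_sum => j _; rewrite normrM ger0_norm// ler_piMr// cos_max.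
apply: nondecreasing_cvgn_le cvg_a n.
by apply: nondecreasing_series => j _ _.
Qed.

Variables (d : nat) (k : nat -> 'rV[int]_d) (c : R ^nat).

Definition character_series (t : d.-tuple mR) : R :=
  cos_series (fun j => character_phase (k j) (c j) t).

(** Dominated convergence: every partial sum is bounded by the constant sum of the [a j]. Termwise,
    only zero frequencies have a nonzero integral. *)
Lemma integral_character_series :
  (torus_measure R d).-integrable setT (fun t => (character_series t)%:E) /\
  series (fun j => a j * ((k j == 0)%:R * cos (c j))) @ \oo -->
    Rintegral (torus_measure R d) setT character_series.
Proof.
pose F n (t : d.-tuple mR) :=
  (series (fun j => a j * cos (character_phase (k j) (c j) t)) n)%:E.
have mF n : measurable_fun setT (F n).
  apply/measurable_EFinP; apply: measurable_sum => j.
  apply: measurable_funM => //; apply: measurable_cos_comp.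
  exact: measurable_character_phase.
have FE t : F n t @[n --> \oo] --> (character_series t)%:E.
  by apply: cvg_EFin; [exact: nearW|exact: cvg_cos_series].
have [||||iS _ IF] := @dominated_convergence _ _ _ (torus_measure R d) _
    measurableT F (fun t => (character_series t)%:E) (fun=> (limn (series a))%:E) mF.
- by apply: (emeasurable_fun_cvg _ _ mF) => t _; exact: FE.
- by apply: aeW => t _; exact: FE.
- exact: finite_measure_integrable_cst.
- by apply: aeW => t n _; rewrite /F /= lee_fin series_cos_le.
split=> //.
have -> : series (fun j => a j * ((k j == 0)%:R * cos (c j))) =
    fine \o (fun n => \int[torus_measure R d]_t F n t)%E.
  apply/funext => n /=; rewrite /F /series /=.
  under eq_integral do rewrite -sumEFin.
  rewrite integral_sum//; last first.
    move=> j; under eq_fun do rewrite EFinM.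
    apply: integrableZl => //; apply: integrable_cos_comp.
    exact: measurable_character_phase.
  under [in RHS]eq_bigr => j _.
    under eq_integral do rewrite EFinM.
    rewrite integralZl//; last first.
      by apply: integrable_cos_comp; exact: measurable_character_phase.
    rewrite integral_torus_cos -EFinM; over.
  by rewrite sumEFin.
by apply: fine_cvg; rewrite fineK ?integrable_fin_num.
Qed.

End CosineSeries.

(** * Exponential series: Fourier coefficients and Sobolev norm *)

Section ExpSeries.
Context {R : realType}.
Set Implicit Arguments.
Unset Strict Implicit.
Local Notation normc := ComplexField.Normc.normc.

Lemma dotpDr d (x y z : 'rV[R]_d) : dotp x (y + z) = dotp x y + dotp x z.
Proof.
by rewrite /dotp -big_split/=; apply: eq_bigr => i _; rewrite mxE mulrDr.
Qed.

Lemma dotpBl d (x y z : 'rV[R]_d) : dotp (x - y) z = dotp x z - dotp y z.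
Proof.
by rewrite /dotp -sumrB; apply: eq_bigr => i _; rewrite !mxE mulrBl.
Qed.

Lemma dotpZr d (x y : 'rV[R]_d) c : dotp x (c *: y) = c * dotp x y.
Proof.
by rewrite /dotp mulr_sumr; apply: eq_bigr => i _; rewrite mxE mulrCA.
Qed.

Lemma dotpC d (x y : 'rV[R]_d) : dotp x y = dotp y x.
Proof. by apply: eq_bigr => i _; rewrite mulrC. Qed.

Lemma dotp_int_row d (k l : 'rV[int]_d) :
  dotp (int_row R k) (int_row R l) = (\sum_i k 0 i * l 0 i)%:~R.
Proof. by rewrite rmorph_sum/=; apply: eq_bigr => i _; rewrite !mxE rmorphM. Qed.

Lemma int_rowB d (k l : 'rV[int]_d) : int_row R (k - l) = int_row R k - int_row R l.
Proof. by apply/rowP => i; rewrite !mxE rmorphB. Qed.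

Variables (a : R ^nat) (d : nat) (m : nat -> 'rV[int]_d).
Hypothesis a_ge0 : forall j, 0 <= a j.
Hypothesis cvg_a : cvgn (series a).

(** The series sum_j a_j e(m_j . x), written by real and imaginary parts. *)
Definition exp_series (x : 'rV[R]_d) : R[i] :=
  (cos_series a (fun j => 2 * pi * dotp (int_row R (m j)) x) +i*
   cos_series a (fun j => 2 * pi * dotp (int_row R (m j)) x - pi / 2))%C.

Lemma exp_series_periodic : Zd_periodic exp_series.
Proof.
move=> x k; congr (_ +i* _)%C; apply: eq_cos_series => j;
  rewrite dotpDr dotp_int_row mulrDr; first by rewrite cosD2piz.
by rewrite addrAC cosD2piz.
Qed.

Lemma exp_series_integrable : torus_integrable exp_series.
Proof.
split.
  have [+ _] := @integral_character_series _ a a_ge0 cvg_a d m (fun=> 0).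
  rewrite /character_series /character_phase.
  by under [X in _ _ X]eq_fun do under eq_fun do rewrite addr0.
by have [] := @integral_character_series _ a a_ge0 cvg_a d m (fun=> - (pi / 2)).
Qed.

Lemma Re_exp_series_mul (x : 'rV[R]_d) (z : R) :
  complex.Re (exp_series x * cexp2pi z) =
  cos_series a (fun j => 2 * pi * (dotp (int_row R (m j)) x + z)).
Proof.
rewrite /exp_series /cexp2pi /= -mulrN.
apply: cos_series_comb => // j.
by rewrite mulrN cosBpihalf -cosD -mulrDr.
Qed.

Lemma Im_exp_series_mul (x : 'rV[R]_d) (z : R) :
  complex.Im (exp_series x * cexp2pi z) =
  cos_series a (fun j => 2 * pi * (dotp (int_row R (m j)) x + z) - pi / 2).
Proof.
rewrite /exp_series /cexp2pi /=.
apply: cos_series_comb => // j.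
by rewrite [2 * pi * (_ + _)]mulrDr !cosBpihalf sinD addrC.
Qed.

(** Multiplying by e(- k . x) replaces m_j by m_j - k, and integration keeps the terms with m_j = k.
    In the imaginary part these carry the factor cos (- pi / 2) = 0. *)
Lemma fourier_coef_exp_series (k : 'rV[int]_d) :
  series (fun j => a j * (m j == k)%:R) @ \oo --> complex.Re (fourier_coef exp_series k) /\
  complex.Im (fourier_coef exp_series k) = 0.
Proof.
have phaseE j x : 2 * pi * (dotp (int_row R (m j)) x - dotp (int_row R k) x) =
    2 * pi * dotp (int_row R (m j - k)) x by rewrite int_rowB dotpBl.
split.
  have -> : complex.Re (fourier_coef exp_series k) =
      Rintegral (torus_measure R d) setT
        (character_series a (fun j => m j - k) (fun=> 0)).
    rewrite -[LHS]/(Rintegral _ _ (fun t => complex.Re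
      (exp_series (row_of t) * cexp2pi (- dotp (int_row R k) (row_of t))))).
    apply: eq_Rintegral => t _; rewrite Re_exp_series_mul.
    by apply: eq_cos_series => j; rewrite phaseE /character_phase addr0.
  have [_] := @integral_character_series _ a a_ge0 cvg_a d (fun j => m j - k) (fun=> 0).
  rewrite (_ : (fun j => a j * _) = (fun j => a j * (m j == k)%:R))//.
  by apply/funext => j; rewrite cos0 mulr1 subr_eq0.
have -> : complex.Im (fourier_coef exp_series k) =
    Rintegral (torus_measure R d) setT
      (character_series a (fun j => m j - k) (fun=> - (pi / 2))).
  rewrite -[LHS]/(Rintegral _ _ (fun t => complex.Im
    (exp_series (row_of t) * cexp2pi (- dotp (int_row R k) (row_of t))))).
  apply: eq_Rintegral => t _; rewrite Im_exp_series_mul.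
  by apply: eq_cos_series => j; rewrite phaseE.
have [_ H] := @integral_character_series _ a a_ge0 cvg_a d (fun j => m j - k)
  (fun=> - (pi / 2)).
apply: (cvg_unique _ H) => //.
rewrite (_ : series _ = fun=> 0); first exact: cvg_cst.
apply/funext => n; apply: big1 => j _.
by rewrite cosN cos_pihalf !mulr0.
Qed.

Lemma torus_integral_exp_series : (forall j, m j != 0) -> torus_integral exp_series = 0.
Proof.
move=> m0.
have [H1 H2] := fourier_coef_exp_series 0.
have -> : torus_integral exp_series = fourier_coef exp_series 0.
  rewrite /fourier_coef; congr torus_integral; apply/funext => x.
  rewrite (_ : cexp2pi _ = 1) ?mulr1//.
  have -> : dotp (int_row R 0) x = 0.
    by apply: big1 => i _; rewrite !mxE mul0r.
  by rewrite /cexp2pi oppr0 mulr0 cos0 sin0.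
rewrite [LHS]complexE H2 mulr0 addr0.
congr (_%:C)%C; apply: (cvg_unique _ H1) => //.
rewrite (_ : series _ = fun=> 0); first exact: cvg_cst.
by apply/funext => n; apply: big1 => j _; rewrite (negbTE (m0 j)) mulr0.
Qed.

Hypothesis m_inj : injective m.

Lemma normc_fourier_coef_exp_series i :
  normc (fourier_coef exp_series (m i)) = a i.
Proof.
have [H1 H2] := fourier_coef_exp_series (m i).
move: H1 H2; case: (fourier_coef _ _) => u v /= H1 ->.
rewrite expr0n/= addr0 sqrtr_sqr; apply/eqP.
have -> : u = a i; last by rewrite ger0_norm.
apply: (cvg_unique _ H1) => //; apply: cvg_near_cst.
near=> n.
(* Beyond index [i] the partial sums are constant, injectivity leaving the single term [a i]. *)
have ni : (i < n)%N by near: n; exists i.+1.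
rewrite /series/= big_mkord (bigD1 (Ordinal ni))//= eqxx mulr1 big1 ?addr0// => j ji.
by rewrite (inj_eq m_inj) (_ : (j == i :> nat) = false) ?mulr0//; apply/negbTE.
Unshelve. all: by end_near. Qed.

Lemma normc_fourier_coef_exp_series0 k : ~ range m k ->
  normc (fourier_coef exp_series k) = 0.
Proof.
move=> km.
have [H1 H2] := fourier_coef_exp_series k.
move: H1 H2; case: (fourier_coef _ _) => u v /= H1 ->.
have -> : u = 0; last by rewrite !expr0n/= addr0 sqrtr0.
apply: (cvg_unique _ H1) => //.
rewrite (_ : series _ = fun=> 0); first exact: cvg_cst.
apply/funext => n; apply: big1 => j _.
by case: eqP => [mjk|]; [case: km; exists j|rewrite mulr0].
Qed.

(** The coefficients vanish off the range of [m], so by injectivity the sum over Z^d becomes a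
    nonnegative series over [j], bounded as soon as its partial sums are. *)
Lemma sobolev_exp_series (delta B : R) :
  (forall n, \sum_(0 <= j < n)
     (1 + enorm (int_row R (m j)) ^+ 2) `^ delta * a j ^+ 2 <= B) ->
  sobolev delta exp_series.
Proof.
move=> sumB; split; [exact: exp_series_periodic|exact: exp_series_integrable|].
rewrite /sobolev_norm; apply: poweR_lty.
rewrite [X in (X < _)%E](_ : _ = \esum_(k in range m)
    ((1 + enorm (int_row R k) ^+ 2) `^ delta *
      normc (fourier_coef exp_series k) ^+ 2)%:E)%E; last first.
  rewrite [RHS]esum_mkcond; apply: eq_esum => k _.
  case: ifPn => //; rewrite notin_setE => /normc_fourier_coef_exp_series0 ->.
  by rewrite expr0n mulr0.
rewrite esum_image; last by move=> ? ? _ _; exact: m_inj.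
under eq_esum do rewrite normc_fourier_coef_exp_series.
have ge0 j : (0 <= ((1 + enorm (int_row R (m j)) ^+ 2) `^ delta * a j ^+ 2)%:E)%E.
  by rewrite lee_fin mulr_ge0 ?powR_ge0 ?exprn_ge0.
rewrite -nneseries_esumT// (@le_lt_trans _ _ B%:E) ?ltry//.
apply: lime_le; first exact: is_cvg_nneseries.
by apply: nearW => n; rewrite sumEFin lee_fin.
Qed.

End ExpSeries.

(** * The discrepancy of an exponential series and its essential supremum *)

Section WeightedSum.
Context {R : realType}.
Set Implicit Arguments.
Unset Strict Implicit.
Local Notation normc := ComplexField.Normc.normc.

(** One list [A] works for every [g], so the discrepancy and all the multipliers become finite sums
    over the same indices. *)
Lemma fsbig_bounded_support (w : int -> R[i]) (M : int) :
  (forall n : int, M < `|n| -> w n = 0) ->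
  exists A : seq int, forall g : int -> R[i],
    \sum_(n \in [set: int]) w n * g n = \sum_(n <- A) w n * g n.
Proof.
move=> w0.
have finM : finite_set [set n : int | `|n| <= M].
  apply: (@sub_finite_set _ _ ((fun i : nat => i%:Z - `|M|%N%:Z) @` `I_(`|M|%N.*2.+1))).
    move=> n /= nM; exists (`|(n + `|M|%N%:Z)%R|%N) => /=; lia.
  by apply: finite_image; exact: finite_II.
exists (finmap.enum_fset (fset_set [set n : int | `|n| <= M])) => g.
apply: fsbigTE => n; rewrite in_fset_set// => /negP nM.
rewrite w0 ?mul0r// ltNge; apply/negP => n_le; apply: nM.
by rewrite inE.
Qed.

Lemma cexp2piD (s t : R) : cexp2pi (s + t) = cexp2pi s * cexp2pi t.
Proof.
rewrite /cexp2pi [2 * pi * (s + t)]mulrDr cosD sinD; apply/eqP.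
by rewrite eq_complex /= eqxx/= addrC.
Qed.

Lemma Re_le_normc (z : R[i]) : complex.Re z <= normc z.
Proof.
case: z => u v /=; apply: le_trans (ler_norm u) _.
by rewrite -sqrtr_sqr ler_sqrt ?lerDl ?addr_ge0 ?sqr_ge0.
Qed.

Lemma cos_ge_half : exists2 h : R, 0 < h & forall t, `|t| < h -> 2^-1 <= cos t.
Proof.
have /cvgr_ge/(_ 2^-1) : cos t @[t --> (0 : R)] --> cos (0 : R) by exact: continuous_cos.
rewrite cos0 invf_lt1 ?ltr1n// => /(_ isT).
move=> /nbhs_ballP[h h0 H]; exists h => // t th; apply: H.
by rewrite /ball/= sub0r normrN.
Qed.

(** Otherwise the box would lie in a null set, although it has positive measure. *)
Lemma torus_esssup_ge d (g : 'rV[R]_d -> R) (e y : R) : 0 < e ->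
  (forall t : d.-tuple (measurableTypeR R),
    (forall i, `|tnth t i| <= e) -> y <= g (row_of t)) ->
  (y%:E <= torus_esssup g)%E.
Proof.
move=> e0 yg; rewrite leNgt; apply/negP => gy.
have [N [mN N0 subN]] := ess_sup_ge (torus_measure R d) (fun t => (g (row_of t))%:E).
have := @torus_measure_box_gt0 R d e e0.
rewrite (subset_measure0 (@measurable_box R d e) mN _ N0) ?ltxx// => t te.
apply: subN => /= /le_lt_trans/(_ gy); apply/negP; rewrite -leNgt lee_fin.
exact: yg.
Qed.

Variables (a : R ^nat) (d : nat) (m : nat -> 'rV[int]_d).
Hypothesis a_ge0 : forall j, 0 <= a j.
Hypothesis cvg_a : cvgn (series a).
Hypothesis m_neq0 : forall j, m j != 0.
Variables (Phi : nat -> int -> R[i]) (N : nat) (M : int) (alpha : 'rV[R]_d).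
Hypothesis Phi0 : forall n : int, M < `|n| -> Phi N n = 0.

(** The weighted average over translates by n alpha multiplies the character of frequency m by this
    function at t = alpha . m. *)
Definition multiplier (t : R) : R[i] :=
  \sum_(n \in [set: int]) Phi N n * cexp2pi (n%:~R * t).

Let f := exp_series a m.

(** Exchanges the finite sum over [A] with the series, one weight u + iv at a time: each contributes
    u times a cosine series minus v times a sine series. *)
Lemma cvg_Re_sum_exp_series (A : seq int) (x : int -> 'rV[R]_d) :
  series (fun j => a j * complex.Re (\sum_(n <- A)
    Phi N n * cexp2pi (dotp (int_row R (m j)) (x n)))) @ \oo -->
  complex.Re (\sum_(n <- A) Phi N n * f (x n)).
Proof.
elim: A => [|n A IH].
  rewrite big_nil (_ : series _ = fun=> 0); first exact: cvg_cst.
  by apply/funext => k; apply: big1 => j _; rewrite big_nil mulr0.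
rewrite big_cons raddfD/=.
have -> : series (fun j => a j * complex.Re (\sum_(n0 <- n :: A)
      Phi N n0 * cexp2pi (dotp (int_row R (m j)) (x n0)))) =
    (fun k => series (fun j => a j * complex.Re
      (Phi N n * cexp2pi (dotp (int_row R (m j)) (x n)))) k +
      series (fun j => a j * complex.Re (\sum_(n <- A)
    Phi N n * cexp2pi (dotp (int_row R (m j)) (x n)))) k).
  apply/funext => k; rewrite /series/= -big_split/=; apply: eq_bigr => j _.
  by rewrite big_cons raddfD/= mulrDr.
apply: cvgD IH.
case: (Phi N n) => u v.
have -> : series (fun j => a j * complex.Re
      ((u +i* v)%C * cexp2pi (dotp (int_row R (m j)) (x n)))) =
    (fun k => series (fun j => a j * cos (2 * pi * dotp (int_row R (m j)) (x n))) k * u +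
      series (fun j => a j * cos (2 * pi * dotp (int_row R (m j)) (x n) - pi / 2)) k * (- v)).
  apply/funext => k; rewrite /series/= !mulr_suml -big_split/=; apply: eq_bigr => j _.
  by rewrite cosBpihalf; ring.
have -> : complex.Re ((u +i* v)%C * f (x n)) =
    cos_series a (fun j => 2 * pi * dotp (int_row R (m j)) (x n)) * u +
    cos_series a (fun j => 2 * pi * dotp (int_row R (m j)) (x n) - pi / 2) * (- v).
  by rewrite /f /exp_series /=; ring.
by apply: cvgD; apply: cvgMr_tmp; exact: cvg_cos_series.
Qed.

(** Translation by n alpha multiplies the j-th character by e(n alpha . m_j), and summation over n
    yields the multiplier. The mean of the series is 0 because no m_j is 0. *)
Lemma cvg_Re_weighted_discrepancy (x : 'rV[R]_d) :
  series (fun j => a j * complex.Re (cexp2pi (dotp (int_row R (m j)) x) *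
    multiplier (dotp alpha (int_row R (m j))))) @ \oo -->
  complex.Re (weighted_discrepancy Phi alpha f N x).
Proof.
have [A sumA] := fsbig_bounded_support Phi0.
rewrite /weighted_discrepancy torus_integral_exp_series// subr0 sumA.
rewrite (_ : (fun j => a j * _) = (fun j => a j * complex.Re (\sum_(n <- A)
    Phi N n * cexp2pi (dotp (int_row R (m j)) (x + n%:~R *: alpha))))).
  exact: cvg_Re_sum_exp_series.
apply/funext => j; congr (_ * complex.Re _).
rewrite /multiplier sumA mulr_sumr; apply: eq_bigr => n _.
by rewrite dotpDr dotpZr cexp2piD (dotpC alpha) mulrCA.
Qed.

Lemma Re_multiplier_bounded :
  exists2 C : R, 0 < C & forall t, complex.Re (multiplier t) <= C.
Proof.
have [A sumA] := fsbig_bounded_support Phi0.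
exists (1 + \sum_(n <- A) (`|complex.Re (Phi N n)| + `|complex.Im (Phi N n)|)).
  by rewrite ltr_wpDr// sumr_ge0// => n _; rewrite addr_ge0.
move=> t; rewrite /multiplier sumA raddf_sum/= ler_wpDl//.
apply: ler_sum => n _; case: (Phi N n) => u v /=.
apply: le_trans (ler_norm _) _; apply: le_trans (ler_normB _ _) _.
by rewrite !normrM lerD// ler_piMr// ?cos_max ?sin_max.
Qed.

Hypothesis multiplier_ge0 : forall t, complex.Im (multiplier t) = 0 /\
  0 <= complex.Re (multiplier t).

Local Notation k j := (complex.Re (multiplier (dotp alpha (int_row R (m j))))).

(** Near the origin finitely many cosines are at least 1/2, and the remaining terms are made smaller
    than [e] by summability, uniformly in the point. *)
Lemma torus_esssup_weighted_discrepancy_ge (J : nat) (e : R) : 0 < e ->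
  ((2^-1 * (\sum_(0 <= j < J) a j * k j) - e)%:E <=
   torus_esssup (fun x => normc (weighted_discrepancy Phi alpha f N x)))%E.
Proof.
move=> e0.
have k_ge0 j : 0 <= k j by have [] := multiplier_ge0 (dotp alpha (int_row R (m j))).
have [C C0 kC] := Re_multiplier_bounded.
have nda : nondecreasing_seq (series a) by apply: nondecreasing_series => j _ _.
(* The cut is moved from [J] to [J0], beyond which the series cannot lose more than [e]. *)
have [J0 JJ0 tail] : exists2 J0, (J <= J0)%N & C * (limn (series a) - series a J0) <= e.
  have eC : 0 < e / C by rewrite divr_gt0.
  have /cvgrPdist_le/(_ _ eC)[J1 _ H] : series a @ \oo --> limn (series a) := cvg_a.
  exists (maxn J J1); first exact: leq_maxl.
  rewrite mulrC -ler_pdivlMr//; apply: le_trans (ler_norm _) _.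
  by apply: H => /=; exact: leq_maxr.
have [h h0 cosh] := cos_ge_half.
(* [B] exceeds the l^1 norm of each m_j with j < J0, so the box of half-side h / (2 (2 pi B)) keeps
   these phases within h / 2. *)
pose B : R := 1 + \sum_(0 <= j < J0) \sum_i `|int_row R (m j) 0 i|.
have B0 : 0 < B.
  by rewrite ltr_wpDr// sumr_ge0// => j _; rewrite sumr_ge0.
have pi0 := pi_gt0 R.
apply: (@torus_esssup_ge _ _ (h / (2 * (2 * pi * B)))) => [|t te].
  by rewrite divr_gt0 ?mulr_gt0.
apply: le_trans _ (Re_le_normc _).
have cvgD := @cvg_Re_weighted_discrepancy (row_of t).
rewrite -(cvg_lim _ cvgD)//.
apply: limr_ge; first by apply/cvg_ex; eexists; exact: cvgD.
have termE j : a j * complex.Re (cexp2pi (dotp (int_row R (m j)) (row_of t)) *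
    multiplier (dotp alpha (int_row R (m j)))) =
    a j * k j * cos (2 * pi * dotp (int_row R (m j)) (row_of t)).
  (* As the multiplier is real, the sine part of the character does not enter the real part. *)
  have [Im0 _] := multiplier_ge0 (dotp alpha (int_row R (m j))).
  move: Im0; case: (multiplier _) => u v /= ->.
  by ring.
have small j : (j < J0)%N -> 2^-1 <= cos (2 * pi * dotp (int_row R (m j)) (row_of t)).
  move=> jJ0; apply: cosh.
  have dB : `|dotp (int_row R (m j)) (row_of t)| <= h / (2 * (2 * pi * B)) * B.
    apply: le_trans (ler_norm_sum _ _ _) _.
    apply: (@le_trans _ _ (\sum_i `|int_row R (m j) 0 i| * (h / (2 * (2 * pi * B))))).
      by apply: ler_sum => i _; rewrite normrM ler_wpM2l// [row_of _ _ _]mxE.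
    rewrite -mulr_suml mulrC ler_wpM2l ?divr_ge0 ?mulr_ge0 ?(ltW h0) ?(ltW B0) ?(ltW pi0)//.
    rewrite /B big_mkord (bigD1 (Ordinal jJ0))//=.
    rewrite addrCA lerDl addr_ge0// sumr_ge0// => l _; exact: sumr_ge0.
  rewrite normrM gtr0_norm ?mulr_gt0//.
  apply: (@le_lt_trans _ _ (2 * pi * (h / (2 * (2 * pi * B)) * B))).
    by rewrite ler_wpM2l// mulr_ge0// ltW.
  have scale (u : R) : u != 0 -> u * (h / (2 * (u * B)) * B) = h / 2.
    by move=> u0; field; rewrite u0 lt0r_neq0.
  rewrite scale; last by rewrite mulf_neq0// lt0r_neq0.
  by rewrite ltr_pdivrMr// ltr_pMr// ltr1n.
near=> n.
have J0n : (J0 <= n)%N by near: n; exists J0.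
rewrite /series/= (big_cat_nat _ J0n)//=.
apply: lerD.
  rewrite mulr_sumr.
  apply: (@le_trans _ _ (\sum_(0 <= j < J0) 2^-1 * (a j * k j))).
    rewrite (big_cat_nat _ JJ0)//= lerDl sumr_ge0// => j _.
    by rewrite !mulr_ge0 ?invr_ge0.
  apply: ler_sum_nat => j /andP[_ jJ0].
  by rewrite termE mulrC ler_wpM2l ?mulr_ge0// small.
(* In the tail the bounds cos >= -1 and [k j] <= [C] suffice. *)
apply: (@le_trans _ _ (\sum_(J0 <= j < n) - (C * a j))).
  rewrite sumrN -mulr_sumr lerN2; apply: le_trans _ tail.
  rewrite ler_wpM2l ?(ltW C0)// -(sub_series_geq _ J0n) lerD2r.
  exact: nondecreasing_cvgn_le.
apply: ler_sum => j _; rewrite termE.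
apply: (@le_trans _ _ (- (a j * k j))).
  by rewrite lerN2 mulrC ler_wpM2r.
by rewrite -mulrN1 ler_wpM2l ?mulr_ge0// cos_geN1.
Unshelve. all: by end_near. Qed.

End WeightedSum.

(** * Divergence criteria and selection of sparse frequencies *)

Section Selection.
Context {R : realType}.
Set Implicit Arguments.
Unset Strict Implicit.

Lemma limn_esup_eq_pinfty (u : (\bar R)^nat) :
  (forall (A : R) n, exists2 N, (n <= N)%N & (A%:E <= u N)%E) ->
  limn_esup u = +oo%E.
Proof.
move=> uA; rewrite limn_esup_lim (_ : esups u = cst +oo%E) ?lim_cst//.
apply/funext => n; apply: eq_infty => A.
have [N nN /le_trans] := uA A n; apply.
by apply: ereal_sup_ubound; exists N.
Qed.

Lemma series_harmonic_unbounded (A : R) : exists J, A <= series harmonic J.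
Proof.
apply/not_existsP => H; apply: (@dvg_harmonic R).
apply: nondecreasing_is_cvgn.
  by apply: nondecreasing_series => j _ _; exact: harmonic_ge0.
exists A => _ [n _ <-]; apply/ltW; rewrite ltNge; apply/negP; exact: H.
Qed.

Lemma sum_inv_sqr_le2 n : \sum_(0 <= j < n) ((j.+1%:R : R)^-1) ^+ 2 <= 2.
Proof.
case: n => [|n]; first by rewrite big_nil.
(* The sharper bound makes the induction close, since 1/x - 1/(x + 1) - 1/(x + 1)^2 = 1/(x (x +
   1)^2) is positive. *)
suff : \sum_(0 <= j < n.+1) ((j.+1%:R : R)^-1) ^+ 2 <= 2 - n.+1%:R^-1.
  by move/le_trans; apply; rewrite gerBl invr_ge0.
elim: n => [|n IH]; first by rewrite big_nat1 invr1 expr1n; lra.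
rewrite big_nat_recr//=; apply: le_trans (lerD IH (lexx _)) _.
have n1 : (0 : R) < n.+1%:R by rewrite ltr0n.
rewrite -[n.+2]addn1 natrD; move: (n.+1%:R : R) n1 => x x0.
rewrite -subr_ge0 (_ : _ - _ = (x * (x + 1) ^+ 2)^-1); last first.
  by field; rewrite !gt_eqF// ?addr_gt0.
by rewrite invr_ge0 mulr_ge0 ?sqr_ge0// ltW.
Qed.

Lemma infinite_nat_unbounded (S : set nat) n : infinite_set S ->
  exists2 N, S N & (n <= N)%N.
Proof.
move=> Sinf; apply: contrapT => H; apply: Sinf.
apply: (@sub_finite_set _ _ `I_n); last exact: finite_II.
by move=> N SN /=; rewrite ltnNge; apply/negP => nN; apply: H; exists N.
Qed.

Lemma norm_le_enorm d (k : 'rV[int]_d) i : `|k 0 i|%:~R <= enorm (int_row R k).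
Proof.
rewrite intr_norm -sqrtr_sqr ler_sqrt; last first.
  by apply: sumr_ge0 => j _; rewrite -expr2 sqr_ge0.
rewrite /dotp (bigD1 i)//= !mxE -expr2 lerDl.
by apply: sumr_ge0 => j _; rewrite -expr2 sqr_ge0.
Qed.

Lemma infinite_set_enorm_unbounded d (Omega : set 'rV[int]_d) (B : R) :
  infinite_set Omega -> exists k, Omega k /\ B < enorm (int_row R k).
Proof.
move=> infO; apply: contrapT => H; apply: infO.
pose n := Num.bound `|B|.
(* If the norms were bounded by B, all entries would lie in [-n, n], and [emb] enumerates these
   finitely many vectors. *)
pose emb (v : 'rV['I_n.*2.+1]_d) : 'rV[int]_d := 
    map_mx (fun i : 'I_n.*2.+1 => i%:Z - n%:Z) v.
apply: (@sub_finite_set _ _ (emb @` [set` predT])); last first.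
  by apply: finite_image; exact: finite_finpred.
move=> k Ok.
have kn i : (absz (k 0 i)%R <= n)%N.
  have : enorm (int_row R k) <= B by rewrite leNgt; apply/negP => ?; apply: H; exists k.
  move=> kB; rewrite -(ler_nat R) ltW//.
  apply: le_lt_trans (archi_boundP (normr_ge0 B)).
  apply: le_trans (ler_norm B); apply: le_trans kB.
  apply: le_trans (norm_le_enorm k i).
  by rewrite -abszE pmulrn.
exists (\row_i inord (absz (k 0 i + n%:Z)%R)) => //.
apply/rowP => i; rewrite !mxE inordK; last by have := kn i; lia.
by have := kn i; lia.
Qed.

(** Each choice exceeds both the prescribed bound and the previous value of [h]; [h] therefore
    increases strictly along the sequence, whence injectivity. *)
Lemma exists_fast_seq (T : Type) (P : T -> Prop) (h : T -> R) (b : R ^nat) :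
  (forall B, exists x, P x /\ B < h x) ->
  exists s : nat -> T, [/\ injective s, forall j, P (s j) & forall j, b j < h (s j)].
Proof.
move=> /choice[g gP].
pose s := fix s j := if j is i.+1 then g (Num.max (b j) (h (s i))) else g (b 0%N).
have sb j : b j < h (s j).
  case: j => [|j] /=; first by have [] := gP (b 0%N).
  by have [_] := gP (Num.max (b j.+1) (h (s j))); rewrite gt_max => /andP[].
have sS j : h (s j) < h (s j.+1).
  by have [_] := gP (Num.max (b j.+1) (h (s j))); rewrite gt_max => /andP[].
have sP j : P (s j) by case: j => [|j] /=; apply: (gP _).1.
exists s; split=> // i j sij.
have hs : {homo (fun j => h (s j)) : i j / (i < j)%N >-> i < j}.
  by apply: homo_ltn sS; exact: lt_trans.
by case: (ltngtP i j) => // /hs; rewrite sij ltxx.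
Qed.

Lemma dist_int_ge0 (t : R) : 0 <= dist_int t.
Proof. by apply: lb_le_inf; [exists `|t - 0%:~R|, 0|move=> _ [n _ <-]]. Qed.

End Selection.

(** * Size of the coefficients of the lacunary series *)

Section Weights.
Context {R : realType}.
Set Implicit Arguments.
Unset Strict Implicit.
Variables (theta sigma : R).
Hypotheses (htheta : 0 < theta) (hsigma : 0 < sigma).

(** [E j] stands for |m_j|. The factor 1 / (j + 1) is square summable but not summable. *)
Definition weight (E : R ^nat) (j : nat) : R :=
  (E j `^ (theta * sigma))^-1 * j.+1%:R^-1.

Variable E : R ^nat.
(** The power gives E_j^(theta sigma) >= 2^j, hence summable weights; the added 1 gives E_j > 1,
    hence 1 + E_j^2 <= 2 E_j^2. *)
Hypothesis E_ge : forall j, 1 + (2 ^+ j) `^ (theta * sigma)^-1 < E j.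

Let E_gt1 j : 1 < E j.
Proof. by apply: le_lt_trans (E_ge j); rewrite lerDl powR_ge0. Qed.

Let tau_gt0 : 0 < theta * sigma. Proof. exact: mulr_gt0. Qed.

Let Etau_gt0 j : 0 < E j `^ (theta * sigma).
Proof. by rewrite powR_gt0// (lt_trans ltr01). Qed.

Lemma weight_ge0 j : 0 <= weight E j.
Proof. by rewrite mulr_ge0 ?invr_ge0// ltW. Qed.

Lemma cvg_series_weight : cvgn (series (weight E)).
Proof.
have half_lt1 : `|2^-1 : R| < 1 by rewrite ger0_norm ?invr_ge0// invf_lt1// ltr1n.
apply: series_le_cvg (is_cvg_geometric_series (a := 1) half_lt1) => j.
- exact: weight_ge0.
- by rewrite /geometric /= mul1r exprn_ge0// invr_ge0.
rewrite /geometric /= mul1r exprVn /weight -[leRHS]mulr1.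
apply: ler_pM; rewrite ?invr_ge0// ?(ltW (Etau_gt0 j))//; last first.
  by rewrite invf_le1// ler1n.
rewrite lef_pV2 ?posrE ?exprn_gt0//.
apply: (@le_trans _ _ (((2 ^+ j) `^ (theta * sigma)^-1) `^ (theta * sigma))).
  by rewrite -powRrM mulVf ?gt_eqF// powRr1// exprn_ge0.
rewrite ge0_ler_powR ?nnegrE ?powR_ge0 ?(ltW tau_gt0)//.
  by rewrite (le_trans ler01)// ltW.
by rewrite ltW// (le_lt_trans _ (E_ge j))// lerDr.
Qed.

(** After 1 + E_j^2 <= 2 E_j^2 the powers of E_j cancel exactly, leaving the sum of 1 / (j +
    1)^2. *)
Lemma sum_weight_sqr_le n :
  \sum_(0 <= j < n) (1 + E j ^+ 2) `^ (theta * sigma) * weight E j ^+ 2 <=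
  2 `^ (theta * sigma) * 2.
Proof.
apply: le_trans (ler_wpM2l (powR_ge0 _ _) (sum_inv_sqr_le2 n)).
rewrite mulr_sumr; apply: ler_sum => j _.
have E0 : 0 <= E j by rewrite (le_trans ler01)// ltW.
apply: (@le_trans _ _ ((2 * (E j * E j)) `^ (theta * sigma) * weight E j ^+ 2)).
  rewrite ler_wpM2r ?exprn_ge0 ?weight_ge0// ge0_ler_powR ?nnegrE ?(ltW tau_gt0)//.
  - by rewrite addr_ge0 ?sqr_ge0.
  - by rewrite !mulr_ge0.
  - by rewrite -expr2 mulr2n mulrDl !mul1r lerD2r expr_ge1// ltW.
rewrite !powRM ?mulr_ge0// /weight.
have := Etau_gt0 j; move: (E j `^ _) => x x0.
rewrite le_eqVlt (_ : _ == _)//; apply/eqP.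
move: (j.+1%:R^-1) (2 `^ _) => y z; field.
exact: lt0r_neq0.
Qed.

(* [1 <= N x^(- sigma)], so [1 + N t <= (1 + L) N x^(- sigma)]. *)
Lemma powR_weight_ge (N L t x : R) : 0 < L -> 0 < x -> x `^ sigma <= N ->
  0 <= t -> t <= L * x `^ (- sigma) ->
  (1 + L) `^ (- theta) <=
  N `^ theta * ((x `^ (theta * sigma))^-1 * (1 + N * t) `^ (- theta)).
Proof.
move=> L0 x0 xN t0 tL.
have xs0 : 0 < x `^ sigma by exact: powR_gt0.
have N0 : 0 < N by exact: lt_le_trans xs0 xN.
have pos : 0 < 1 + N * t by rewrite ltr_pwDl// mulr_ge0// ltW.
have L1 : 0 < 1 + L by rewrite addr_gt0.
have bound : (1 + N * t) * x `^ sigma <= N * (1 + L).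
  have : N * t * x `^ sigma <= N * L.
    rewrite -mulrA ler_wpM2l ?(ltW N0)//.
    by move: tL; rewrite powRN ler_pdivlMr.
  by rewrite mulrDl mul1r mulrDr mulr1 => ?; rewrite lerD.
rewrite !powRN (mulrC theta) powRrM -invfM -powRM ?powR_ge0 ?(ltW pos)//.
rewrite ler_pdivlMr ?powR_gt0 ?mulr_gt0// mulrC ler_pdivrMr ?powR_gt0//.
rewrite -powRM ?(ltW N0) ?(ltW L1)// ge0_ler_powR ?nnegrE ?(ltW htheta)//.
- by rewrite mulr_ge0 ?(ltW xs0) ?(ltW pos).
- by rewrite mulr_ge0 ?(ltW N0) ?(ltW L1).
by rewrite mulrC.
Qed.

End Weights.

(** * Construction of the function and divergence of its discrepancy *)

Theorem theorem1p6 (R : realType) (d : nat) (hd : (0 < d)%N)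
  (theta sigma : R) (htheta : 0 < theta) (hsigma : 0 < sigma)
  (Phi : nat -> int -> R[i])
  (Phi_bounded_support : forall N : nat, (0 < N)%N ->
     exists M : int, forall n : int, M < `|n| -> Phi N n = 0)
  (Phi_sum1 : forall N : nat, (0 < N)%N ->
     \sum_(n \in [set: int]) Phi N n = 1)
  (Phi_lower_bound : exists (H : R) (S : set nat),
     [/\ 0 < H, infinite_set S &
       forall N : nat, S N -> (0 < N)%N /\
         forall t : R,
           let s := \sum_(n \in [set: int]) Phi N n * cexp2pi (n%:~R * t) in
           complex.Im s = 0 /\
           H * (1 + N%:R * dist_int t) `^ (- theta) <= complex.Re s])
  (alpha : 'rV[R]_d)
  (alpha_approx : exists (L : R) (Omega : set 'rV[int]_d),
     [/\ 0 < L, infinite_set Omega &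
       forall m : 'rV[int]_d, Omega m -> m != 0 /\
         dist_int (dotp alpha (int_row R m)) <=
           L * enorm (int_row R m) `^ (- sigma)]) :
  exists f : 'rV[R]_d -> R[i],
    sobolev (theta * sigma) f /\
    limn_esup (fun N : nat =>
      ((N%:R `^ theta)%:E *
       torus_esssup (fun x =>
         ComplexField.Normc.normc (weighted_discrepancy Phi alpha f N x)))%E)
    = +oo%E.
Proof.
have [H [S [H0 S_inf S_lb]]] := Phi_lower_bound.
have [L [W [L0 W_inf W_approx]]] := alpha_approx.
have [m [m_inj m_W m_big]] := exists_fast_seq
  (fun j => 1 + (2 ^+ j) `^ (theta * sigma)^-1)
  (fun B : R => infinite_set_enorm_unbounded B W_inf).
pose E j : R := enorm (int_row R (m j)).
have E0 j : 0 < E j.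
  by rewrite (lt_trans _ (m_big j))// ltr_pwDl// powR_ge0.
pose a := weight theta sigma E.
have a_ge0 : forall j, 0 <= a j := weight_ge0 m_big.
have cvg_a : cvgn (series a) := cvg_series_weight htheta hsigma m_big.
have m_neq0 j : m j != 0 by have [] := W_approx _ (m_W j).
exists (exp_series a m); split.
  exact: sobolev_exp_series a_ge0 cvg_a m_inj _ _ (sum_weight_sqr_le htheta hsigma m_big).
apply: limn_esup_eq_pinfty => A n.
pose c := H * (1 + L) `^ (- theta).
have c0 : 0 < c by rewrite mulr_gt0// powR_gt0// addr_gt0.
(* The factor 2 offsets the 1/2 lost on the box, and the 1 added to [A] offsets the error term. *)
have [J AJ] := series_harmonic_unbounded ((A + 1) * 2 / c).
(* Any [N] of [S] above this sum satisfies |m_j|^sigma <= N for all j < J at once. *)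
pose B := \sum_(0 <= j < J) E j `^ sigma.
have [N SN] := @infinite_nat_unbounded _ (maxn n (Num.bound B)) S_inf.
rewrite geq_max => /andP[nN BN]; exists N => //.
have [N_gt0 mult_lb] := S_lb N SN.
have [M Phi0] := Phi_bounded_support N N_gt0.
have NR : (0 : R) < N%:R by rewrite ltr0n.
have Ntheta : 0 < N%:R `^ theta :> R by rewrite powR_gt0.
have mult_ge0 t : complex.Im (multiplier Phi N t) = 0 /\ 0 <= complex.Re (multiplier Phi N t).
  have [Im0 lb] := mult_lb t; split=> //; apply: le_trans lb.
  by rewrite mulr_ge0 ?powR_ge0// ltW.
have B_ge j : (j < J)%N -> E j `^ sigma <= N%:R.
  move=> jJ; apply: (@le_trans _ _ B).
    by rewrite /B big_mkord (bigD1 (Ordinal jJ))//= lerDl sumr_ge0// => i _; exact: powR_ge0.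
  apply: le_trans (_ : (Num.bound B)%:R <= _); last by rewrite ler_nat.
  by rewrite ltW// archi_boundP// sumr_ge0// => i _; exact: powR_ge0.
(* With the error N^(- theta), multiplication by N^theta costs exactly 1. *)
have Ne : 0 < (N%:R `^ theta)^-1 :> R by rewrite invr_gt0.
have := torus_esssup_weighted_discrepancy_ge a_ge0 cvg_a m_neq0 alpha Phi0 mult_ge0 J Ne.
rewrite -(@lee_pmul2l _ (N%:R `^ theta)%:E)//; apply: le_trans.
rewrite -EFinM lee_fin mulrBr divff ?gt_eqF// lerBrDr mulrCA.
apply: (@le_trans _ _ (2^-1 * (c * series harmonic J))).
  move: AJ; rewrite ler_pdivrMr// => AJ.
  by rewrite mulrC ler_pdivlMr// [c * _]mulrC.
rewrite ler_wpM2l ?invr_ge0// !mulr_sumr; apply: ler_sum_nat => j /andP[_ jJ].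
set t := dotp alpha (int_row R (m j)).
have dist_le : dist_int t <= L * E j `^ (- sigma) by have [] := W_approx _ (m_W j).
have key := powR_weight_ge htheta L0 (E0 j) (B_ge j jJ) (dist_int_ge0 t) dist_le.
have [_ lb] := mult_lb t.
(* The lower bound of the multiplier is inserted as an intermediate term; comparing it with c / (j +
   1) is [key] times H / (j + 1). *)
apply: (@le_trans _ _ (N%:R `^ theta * (a j * (H * (1 + N%:R * dist_int t) `^ (- theta))))).
  rewrite /a /weight /= /c.
  rewrite [leRHS](_ : _ = H * (N%:R `^ theta * ((E j `^ (theta * sigma))^-1 *
    (1 + N%:R * dist_int t) `^ (- theta))) * j.+1%:R^-1); last by ring.
  by rewrite ler_wpM2r ?invr_ge0// ler_wpM2l// ltW.
by rewrite !ler_wpM2l// ltW.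
Qed.
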